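(* Let $A\in BL(X)\setminus\mathcal{I}$. Then $$d_2(A)=\max\left\{\epsilon>0:\ 0\notin\sigma_{\frac{\epsilon}{\|A\|}}(A)\right\}.$$
   Context: $X$ is a complex Banach space, $BL(X)$ is the Banach algebra of all bounded linear operators on $X$, with identity $I$, and $\mathcal{I}=\{zI: z\in\mathbb{C}\}$. The spectrum of $A\in BL(X)$ is $\sigma(A)=\{z\in\mathbb{C}: A-zI \text{ is not invertible}\}$. For $0<\delta<1$ the $\delta$-condition pseudospectrum of $A$ is $$\sigma_\delta(A)=\sigma(A)\cup\{z\in\mathbb{C}: \|A-zI\|\,\|(A-zI)^{-1}\|\ge \delta^{-1}\},$$ and $\sigma_1(A)=\mathbb{C}$. The distance to singularity of $A$ is $$d_2(A):=\min\{\|E\|: A+E\text{ is singular}\},$$ where $A+E$ is singular means $0\in\sigma(A+E)$.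
   Formalization: The maximum is read as a supremum (0 for the empty set, i.e. A singular), since for invertible A the set is the open interval (0, 1/‖A⁻¹‖), which has no maximum; the min in d_2(A) is read as an infimum, and σ_δ(A) is taken to be ℂ for δ>1. *)

(* Defs.v *)
From HB Require Import structures.
From mathcomp Require Import all_boot all_order all_algebra.
From mathcomp Require Import all_classical all_reals all_analysis.
From mathcomp Require Import complex.

Set Implicit Arguments.
Unset Strict Implicit.
Unset Printing Implicit Defensive.

Import Order.TTheory GRing.Theory Num.Theory.
Import numFieldNormedType.Exports.

Local Open Scope classical_set_scope.
Local Open Scope complex_scope.
Local Open Scope ring_scope.

Section Operators.
Context {R : realType} {X : completeNormedModType R[i]}.

(* BL(X), as a subset of the linear endomorphisms of X. *)
Definition BL : set {linear X -> X} :=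
  [set A | bounded_near A (nbhs (0 : X))].

(* {zI : z in C} *)
Definition scalar_op : set {linear X -> X} :=
  [set A | exists z : R[i], forall x, A x = z *: x].

Definition op_add (A B : {linear X -> X}) : {linear X -> X} := A \+ B.

(* A - zI *)
Definition op_shift (A : {linear X -> X}) (z : R[i]) : {linear X -> X} :=
  A \- z \*: idfun.

(* The norm of X takes its values in R[i] (on the nonnegative real axis);
   complex.Re brings it back to R. *)
Definition op_norm (A : {linear X -> X}) : R :=
  sup [set complex.Re `|A x| | x in [set x : X | `|x| <= 1]].

(* B is the inverse of A in the algebra BL(X). *)
Definition op_inverse (A B : {linear X -> X}) : Prop :=
  [/\ BL B, cancel A B & cancel B A].

Definition op_invertible (A : {linear X -> X}) : Prop :=
  exists B, op_inverse A B.

Definition spectrum (A : {linear X -> X}) : set R[i] :=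
  [set z | ~ op_invertible (op_shift A z)].

(* Meaningful for 0 < delta <= 1, with the convention that it is the whole
   plane at delta = 1.  For delta > 1 it is the whole plane as well, which is
   also what the formula gives there, as ||T|| ||T^-1|| >= 1 for every
   invertible T (on a nonzero space). *)
Definition cond_pseudospectrum (delta : R) (A : {linear X -> X}) : set R[i] :=
  if delta < 1 then
    spectrum A `|`
    [set z | exists2 B, op_inverse (op_shift A z) B &
                        op_norm (op_shift A z) * op_norm B >= delta^-1]
  else setT.

Definition singular (A : {linear X -> X}) : Prop := spectrum A 0.

(* The distance to singularity is an infimum: it need not be attained in a
   general Banach space. *)
Definition dist_singular (A : {linear X -> X}) : R :=
  inf [set op_norm E | E in [set E | BL E /\ singular (op_add A E)]].

End Operators.

Arguments BL {R} X.
Arguments scalar_op {R} X.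

(* Main.v *)
(* If A is singular, both sides vanish: E = 0 is admissible on the left, and
   the set on the right is empty, with sup 0 by convention.  If A is invertible
   with inverse B, both sides equal 1/||B||.  On the right this is a
   computation.  On the left, ||E|| ||B|| < 1 keeps A + E invertible, by a
   contraction argument; and if y in the unit ball nearly attains ||B||, then
   E = - f(.) y / ||B y||, for f a norming functional of B y, has norm at most
   1/||B y|| and A + E kills B y.  The norming functional comes from the
   Hahn-Banach theorem: a minimal sublinear functional is linear. *)
Require Import Defs.
From HB Require Import structures.
From mathcomp Require Import all_boot all_order all_algebra.
From mathcomp Require Import all_classical all_reals all_analysis.
From mathcomp Require Import complex.
From mathcomp Require Import ring lra.
Import Order.TTheory GRing.Theory Num.Theory.
Import numFieldNormedType.Exports.
Local Open Scope classical_set_scope.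
Local Open Scope complex_scope.
Local Open Scope ring_scope.

Set Implicit Arguments.
Unset Strict Implicit.
Unset Printing Implicit Defensive.

(** * The real Hahn-Banach theorem, through minimal sublinear functionals *)

Section HahnBanach.
Context {R : realType} {V : lmodType R}.
Implicit Types (p q : V -> R) (x y : V).

Definition sublinear p :=
  (forall x y, p (x + y) <= p x + p y) /\
  (forall t x, 0 <= t -> p (t *: x) = t * p x).

(** The bound for [t^-1] at the vector [t *: x] is the reverse of the bound for [t] at [x], so one
    inequality gives homogeneity. *)
Lemma sublinearP_le p :
  p 0 = 0 -> (forall x y, p (x + y) <= p x + p y) ->
  (forall t x, 0 < t -> p (t *: x) <= t * p x) -> sublinear p.
Proof.
move=> p0 pD pZ; split=> // t x; rewrite le_eqVlt => /predU1P[<-|t0].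
  by rewrite scale0r mul0r.
apply/le_anti; rewrite pZ//=.
by rewrite -ler_pdivlMl//; apply: le_trans (pZ _ _ _); rewrite ?invr_gt0//
  scalerA mulVf ?scale1r ?gt_eqF.
Qed.

Lemma sublinear0 p : sublinear p -> p 0 = 0.
Proof. by move=> [_ /(_ 0 0 (lexx 0))]; rewrite scale0r mul0r. Qed.

Lemma sublinear_geN p x : sublinear p -> - p (- x) <= p x.
Proof.
move=> ps; rewrite -subr_ge0 opprK -(sublinear0 ps) -(subrr x); exact: ps.1.
Qed.

(** For sublinear [q], the largest sublinear functional below [q] whose value at [- x0] is at most
    [- q x0]. *)
Definition directional q x0 y : R :=
  inf [set q (y + t *: x0) - t * q x0 | t in [set t : R | 0 <= t]].

(** Makes the infimum in [directional] a genuine one: [t * q x0 = q (t *: x0)], and [t *: x0] is the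
    sum of [y + t *: x0] and [- y]. *)
Lemma directional_lb q x0 y : sublinear q ->
  lbound [set q (y + t *: x0) - t * q x0 | t in [set t : R | 0 <= t]] (- q (- y)).
Proof.
move=> [qD qZ] _ [t /= t0 <-]; rewrite -qZ// lerBrDr addrC lerBlDr.
by apply: le_trans (qD _ _); rewrite addrAC subrr add0r.
Qed.

Lemma directional_le q x0 y t : sublinear q -> 0 <= t ->
  directional q x0 y <= q (y + t *: x0) - t * q x0.
Proof.
move=> qs t0; apply: ge_inf; last by exists t.
by exists (- q (- y)); exact: directional_lb.
Qed.

Lemma directional_ge q x0 y M :
  (forall t, 0 <= t -> M <= q (y + t *: x0) - t * q x0) ->
  M <= directional q x0 y.
Proof.
move=> H; apply: lb_le_inf; first by eexists; exists 0 => //=.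
by move=> _ [t /= t0 <-]; exact: H.
Qed.

Lemma directional_le_self q x0 y : sublinear q -> directional q x0 y <= q y.
Proof.
move=> qs; apply: le_trans (directional_le x0 y qs (lexx 0)) _.
by rewrite scale0r addr0 mul0r subr0.
Qed.

Lemma directionalN q x0 : sublinear q -> directional q x0 (- x0) <= - q x0.
Proof.
move=> qs; apply: le_trans (directional_le x0 _ qs ler01) _.
by rewrite scale1r addNr sublinear0// mul1r sub0r.
Qed.

Lemma sublinear_directional q x0 : sublinear q -> sublinear (directional q x0).
Proof.
move=> qs; have [qD qZ] := qs; apply: sublinearP_le.
- apply/le_anti/andP; split.
    by rewrite -[leRHS](sublinear0 qs) directional_le_self.
  by apply: directional_ge => t t0; rewrite add0r qZ// subrr.
- move=> x y; rewrite -lerBlDr; apply: directional_ge => t t0.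
  rewrite lerBlDr -lerBlDl.
  apply: directional_ge => s s0.
  rewrite lerBlDl.
  (* Parameters [s] for [y] and [t] for [x] add up to an admissible parameter for [x + y]. *)
  apply: le_trans (directional_le x0 _ qs (addr_ge0 s0 t0)) _.
  have := qD (y + s *: x0) (x + t *: x0).
  have -> : y + s *: x0 + (x + t *: x0) = x + y + (s + t) *: x0.
    by rewrite scalerDl addrACA [y + x]addrC.
  lra.
- move=> a x a0; rewrite -ler_pdivrMl//; apply: directional_ge => t t0.
  rewrite ler_pdivrMl//.
  apply: le_trans (directional_le x0 _ qs (mulr_ge0 (ltW a0) t0)) _.
  by rewrite -scalerA -scalerDr (qZ _ _ (ltW a0)) mulrBr mulrA.
Qed.

(* Minimality forces [directional q x0 = q], and evaluating at [- x0] shows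
   that q is odd. *)
Lemma minimal_sublinear_scalar q : sublinear q ->
  (forall q', sublinear q' -> (forall x, q' x <= q x) -> q' = q) -> scalar q.
Proof.
move=> qs qmin.
have qN x : q (- x) = - q x.
  apply/le_anti/andP; split.
    have dq : directional q x = q.
      by apply: qmin => [|y]; [exact: sublinear_directional|
                               exact: directional_le_self].
    by rewrite -[in leLHS]dq; exact: directionalN.
  by rewrite lerNl; exact: sublinear_geN.
have [qD qZ] := qs.
have qZr a x : q (a *: x) = a * q x.
  have [a0|a0] := leP 0 a; first exact: qZ.
  have Na0 : 0 <= - a by rewrite oppr_ge0 ltW.
  by rewrite -[a]opprK scaleNr qN (qZ _ _ Na0) !mulNr.
have qDe x y : q (x + y) = q x + q y.
  apply/le_anti; rewrite qD /= -[x + y]opprK qN lerNr !opprD.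
  by rewrite -!qN qD.
by move=> a x y; rewrite qDe qZr.
Qed.

(** The pointwise infimum works: it is finite because every member is at least [- p (- x)] at [x],
    and it is subadditive because the family is totally ordered. *)
Lemma sublinear_chain_inf (C : set (V -> R)) p : C !=set0 ->
  (forall q, C q -> sublinear q /\ forall x, q x <= p x) ->
  (forall q q', C q -> C q' -> (forall x, q x <= q' x) \/ (forall x, q' x <= q x)) ->
  exists2 m, sublinear m & forall q, C q -> forall x, m x <= q x.
Proof.
move=> [q0 Cq0] Cp Ctot.
pose m x := inf [set q x | q in C].
have lb x : lbound [set q x | q in C] (- p (- x)).
  move=> _ [q /= Cq <-]; have [qs qp] := Cp _ Cq.
  by apply: le_trans (sublinear_geN x qs); rewrite lerN2.
have mle q x : C q -> m x <= q x.
  by move=> Cq; apply: ge_inf; [exists (- p (- x)); exact: lb|exists q].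
have mge x M : (forall q, C q -> M <= q x) -> M <= m x.
  move=> H; apply: lb_le_inf; first by exists (q0 x); exists q0.
  by move=> _ [q /= Cq <-]; exact: H.
exists m; last by move=> q Cq x; exact: mle.
apply: sublinearP_le.
- apply/le_anti/andP; split.
    by rewrite -[leRHS](sublinear0 (Cp _ Cq0).1) mle.
  by apply: (mge) => q Cq; rewrite sublinear0//; exact: (Cp _ Cq).1.
- move=> x y; rewrite -lerBlDr; apply: (mge) => q Cq.
  rewrite lerBlDr -lerBlDl; apply: (mge) => q' Cq'.
  rewrite lerBlDl.
  (* The smaller of [q] and [q'] can be used at both [x] and [y]. *)
  have [qq'|qq'] := Ctot _ _ Cq Cq'.
    apply: le_trans (mle _ _ Cq) _; apply: le_trans ((Cp _ Cq).1.1 _ _) _.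
    by rewrite lerD2l.
  apply: le_trans (mle _ _ Cq') _; apply: le_trans ((Cp _ Cq').1.1 _ _) _.
  by rewrite lerD2r.
- move=> a x a0; rewrite -ler_pdivrMl//; apply: (mge) => q Cq.
  by rewrite ler_pdivrMl// -((Cp _ Cq).1.2 _ _ (ltW a0)) mle.
Qed.

Lemma exists_minimal_sublinear p : sublinear p ->
  exists q, [/\ sublinear q, forall x, q x <= p x &
    forall q', sublinear q' -> (forall x, q' x <= q x) -> q' = q].
Proof.
move=> ps.
pose T := {q : V -> R | sublinear q /\ forall x, q x <= p x}.
(* The order is reversed, so that a maximal element in Zorn's lemma is a minimal functional. *)
pose le (q q' : T) := `[< forall x, sval q' x <= sval q x >].
have [] := @Zorn T le.
- by move=> q; apply/asboolP => x.
- move=> q r s /asboolP qr /asboolP rs; apply/asboolP => x.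
  exact: le_trans (rs x) (qr x).
- move=> [q qP] [r rP] /asboolP/= qr /asboolP/= rq; apply: eq_exist.
  by apply/funext => x; apply/le_anti; rewrite qr rq.
(* The empty chain is bounded by [p] itself. *)
- move=> C Ctot; have [[q0 Cq0]|C0] := pselect (C !=set0); last first.
    exists (exist _ p (conj ps (fun x => lexx (p x)))) => s Cs.
    by case: C0; exists s.
  have [|||m ms mle] := @sublinear_chain_inf [set sval q | q in C] p.
  + by exists (sval q0); exists q0.
  + by move=> _ [q _ <-]; exact: (svalP q).
  + move=> _ _ [q Cq <-] [q' Cq' <-].
    by have [/asboolP|/asboolP] := Ctot _ _ Cq Cq'; [right|left].
  have mp x : m x <= p x.
    apply: (@le_trans _ _ (sval q0 x)); last exact: (svalP q0).2.
    by apply: (mle); exists q0.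
  exists (exist _ m (conj ms mp)) => s Cs; apply/asboolP => x /=.
  by apply: mle; exists s.
move=> [q [qs qp]] qmin; exists q; split=> // q' q's q'q.
have q'p x : q' x <= p x by exact: le_trans (q'q x) (qp x).
by have /(congr1 sval) := qmin (exist _ q' (conj q's q'p)) (asboolT q'q).
Qed.

(** A minimal [u] below [directional p x0] is linear and satisfies [u (- x0) <= - p x0]; by oddness
    [u x0] is then at least [p x0]. *)
Theorem hahn_banach p x0 : sublinear p ->
  exists u : V -> R, [/\ scalar u, forall x, u x <= p x & u x0 = p x0].
Proof.
move=> ps.
have [u [us ule umin]] := exists_minimal_sublinear (sublinear_directional x0 ps).
have ul := minimal_sublinear_scalar us umin.
have up x : u x <= p x by apply: le_trans (ule x) _; exact: directional_le_self.
exists u; split=> //; apply/le_anti; rewrite up /=.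
have uN : u (- x0) = - u x0.
  have := ul (-1) x0 0; rewrite addr0 scaleN1r (sublinear0 us) addr0 => ->.
  by rewrite mulN1r.
by rewrite -lerN2 -uN; apply: le_trans (ule _) (directionalN x0 ps).
Qed.

End HahnBanach.

(** * Restriction of scalars from the complex to the real numbers *)

Section RealRestriction.
Context {R : realType}.

(** An alias of the carrier, so that the real module structure does not compete with the complex
    one. *)
Definition real_restriction (V : lmodType R[i]) : Type := V.

Variable V : lmodType R[i].

HB.instance Definition _ := GRing.Zmodule.copy (real_restriction V) V.

Let scale (t : R) (x : real_restriction V) : real_restriction V :=
  t%:C *: (x : V).

Let scaleA a b x : scale a (scale b x) = scale (a * b) x.
Proof. by rewrite /scale scalerA rmorphM. Qed.
Let scale1 : left_id 1 scale.
Proof. by move=> x; rewrite /scale scale1r. Qed.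
Let scaleDr : right_distributive scale +%R.
Proof. by move=> t x y; rewrite /scale scalerDr. Qed.
Let scaleDl x : {morph scale^~ x : a b / a + b}.
Proof. by move=> a b; rewrite /scale rmorphD scalerDl. Qed.

HB.instance Definition _ := GRing.Zmodule_isLmodule.Build R
  (real_restriction V) scaleA scale1 scaleDr scaleDl.

Lemma real_restriction_scaleE (t : R) (x : real_restriction V) :
  t *: x = t%:C *: (x : V).
Proof. by []. Qed.

End RealRestriction.

(** * The norm with values in [R], and the complex Hahn-Banach theorem *)

Section RealNorm.
Context {R : realType} {X : normedModType R[i]}.
Implicit Types x y : X.

Definition rnorm x : R := complex.Re `|x|.

Lemma rnormE x : `|x| = (rnorm x)%:C.
Proof. by rewrite /rnorm RRe_real// normr_real. Qed.

Lemma rnorm_ge0 x : 0 <= rnorm x.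
Proof. by rewrite -ler0c -rnormE. Qed.

Lemma rnorm_eq0 x : (rnorm x == 0) = (x == 0).
Proof. by rewrite -[RHS]normr_eq0 rnormE -(inj_eq (@complexI R)). Qed.

Lemma rnorm0 : rnorm (0 : X) = 0.
Proof. by apply/eqP; rewrite rnorm_eq0. Qed.

Lemma rnormD x y : rnorm (x + y) <= rnorm x + rnorm y.
Proof. by rewrite -lecR rmorphD/= -!rnormE ler_normD. Qed.

Lemma rnormB x y : rnorm (x - y) = rnorm (y - x).
Proof. by rewrite /rnorm distrC. Qed.

Lemma rnormZ (c : R[i]) x : rnorm (c *: x) = complex.Re `|c| * rnorm x.
Proof.
apply: complexI; rewrite -rnormE normrZ rmorphM/=.
by congr (_ * _); exact: rnormE.
Qed.

Lemma rnormZ_real (t : R) x : rnorm (t%:C *: x) = `|t| * rnorm x.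
Proof. by rewrite rnormZ normc_def/= expr0n addr0 sqrtr_sqr. Qed.

(* The real part [u] of a complex functional [f] determines it, by
   [f x = u x - i u (i x)]. *)
Theorem complex_hahn_banach x0 : exists f : X -> R[i],
  [/\ scalar f, forall x, `|f x| <= `|x| & f x0 = `|x0|].
Proof.
have ps : @sublinear R (real_restriction X) rnorm.
  split=> [x y|t x t0]; first exact: rnormD.
  by rewrite real_restriction_scaleE rnormZ_real ger0_norm.
have [u [ul up ux0]] := hahn_banach (x0 : real_restriction X) ps.
have uD x y : u (x + y) = u x + u y by have := ul 1 x y; rewrite scale1r mul1r.
have u0 : u 0 = 0 by have := uD 0 0; rewrite addr0; lra.
have uZ (t : R) (x : X) : u (t%:C *: x) = t * u x.
  by have := ul t x 0; rewrite !addr0 u0 addr0.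
have uN x : u (- x) = - u x.
  by have := uZ (-1) x; rewrite rmorphN1 scaleN1r mulN1r.
pose f (x : X) : R[i] := u x -i* u ('i *: x).
have fl : scalar f.
  move=> [a b] x y; rewrite /f.
  have aE : a +i* b = a%:C + b%:C * 'i by simpc.
  have iiE : 'i * 'i = -1 :> R[i] by rewrite -expr2 sqr_i.
  rewrite scalerDr scalerA [in 'i * _]aE mulrDr mulrCA iiE mulrN1.
  rewrite ['i * a%:C]mulrC aE !scalerDl -!scalerA scaleNr !uD uN !uZ.
  by simpc; apply/eqP; rewrite eq_complex /=; apply/andP; split; apply/eqP; ring.
have Ref x : complex.Re (f x) = u x by [].
have fb x : `|f x| <= `|x|.
  have [->|fx0] := eqVneq (f x) 0; first by rewrite normr0 normr_ge0.
  (* A unimodular factor rotating [f x] onto the nonnegative real axis, where [f] coincides with its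
     real part [u] and the bound on [u] applies. *)
  pose c := (f x)^* / `|f x|.
  have nc : `|c| = 1.
    by rewrite /c normrM normfV normr_id normcJ mulfV ?normr_eq0.
  have fcx : f (c *: x) = `|f x|.
    have := fl c x 0; rewrite !addr0.
    have -> : f 0 = 0 by rewrite /f scaler0 u0 oppr0.
    rewrite addr0 => ->; rewrite /c mulrAC [_^* * _]mulrC -sqr_normc expr2.
    by rewrite mulfK ?normr_eq0.
  have := up (c *: x); rewrite -Ref fcx rnormZ nc mul1r.
  by rewrite [X in _ -> _ <= X]rnormE -lecR RRe_real ?normr_real.
exists f; split=> //.
have Rex0 : complex.Re (f x0) = rnorm x0 by rewrite Ref ux0.
(* The real part of [f x0] already exhausts the bound on its modulus, leaving no room for an
   imaginary part. *)
have Imx0 : complex.Im (f x0) = 0.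
  have := fb x0; rewrite -(ler_pXn2r (ltn0Sn 1)) ?nnegrE ?normr_ge0//.
  rewrite -add_Re2_Im2 rnormE -rmorphXn lecR Rex0 gerDl => h.
  by apply/eqP; rewrite -sqrf_eq0; apply/eqP/le_anti; rewrite h sqr_ge0.
by rewrite [LHS]complexE Imx0 mulr0 addr0 Rex0 -rnormE.
Qed.

End RealNorm.

(** * Completeness and the contraction principle *)

Section FixedPoint.
Context {R : realType} {X : completeNormedModType R[i]}.

(** Completeness of [X] with real tolerances; a positive element of [R[i]] is real, so nothing is
    lost. *)
Lemma rnorm_cauchy_cvg (y : nat -> X) :
  (forall e : R, 0 < e ->
    exists N, forall n, (N <= n)%N -> rnorm (y N - y n) < e) ->
  exists l, forall e : R, 0 < e ->
    exists N, forall n, (N <= n)%N -> rnorm (l - y n) < e.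
Proof.
move=> yC.
have : cvgn y.
  apply/cauchy_cvgP/cauchy_ballP => e e0.
  have eE : e = (complex.Re e)%:C by rewrite RRe_real// gtr0_real.
  have e20 : 0 < complex.Re e / 2 by rewrite divr_gt0// -ltcR -eE.
  have [N yN] := yC _ e20.
  near_simpl; near=> n m; rewrite -ball_normE /= rnormE eE ltcR.
  have := rnormD (y n - y N) (y N - y m); rewrite addrA subrK.
  have : rnorm (y n - y N) < complex.Re e / 2.
    by rewrite rnormB; apply: yN; near: n; exact: nbhs_infty_ge.
  have : rnorm (y N - y m) < complex.Re e / 2.
    by apply: yN; near: m; exact: nbhs_infty_ge.
  lra.
move=> /cvgrPdist_lt yl; exists (limn y) => e e0.
have /yl [N _ yN] : 0 < e%:C by rewrite ltcR.
by exists N => n Nn; have := yN n Nn; rewrite /= rnormE ltcR.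
Unshelve. all: by end_near. Qed.

Lemma rnorm_contraction_fixpoint (h : X -> X) (q : R) : 0 <= q < 1 ->
  (forall x y, rnorm (h x - h y) <= q * rnorm (x - y)) -> exists x, h x = x.
Proof.
move=> /andP[q0 q1] hq; pose y n := iter n h 0.
(* The sum of the geometric series that dominates all steps of the iteration from 0. *)
pose D := rnorm (y 1%N - y 0%N) / (1 - q).
have D0 : 0 <= D by rewrite divr_ge0 ?rnorm_ge0// subr_ge0 ltW.
have step n : rnorm (y n.+1 - y n) <= (1 - q) * D * q ^+ n.
  elim: n => [|n IH].
    by rewrite /D expr0 mulr1 mulrC divfK// gt_eqF// subr_gt0.
  apply: le_trans (hq _ _) _; rewrite exprS mulrCA.
  exact: ler_wpM2l.
(* Keeping the exact partial geometric sum makes the induction step an identity. *)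
have dist n m : rnorm (y n - y (n + m)%N) <= D * q ^+ n * (1 - q ^+ m).
  elim: m => [|m IH]; first by rewrite addn0 subrr rnorm0 expr0 subrr mulr0.
  have := rnormD (y n - y (n + m)%N) (y (n + m)%N - y (n + m).+1).
  rewrite addrA subrK addnS [X in _ <= _ + X]rnormB => h1.
  have := step (n + m)%N; rewrite exprD exprS.
  set a := q ^+ n; set b := q ^+ m => h2.
  apply: le_trans h1 _; apply: le_trans (lerD IH h2) _.
  by rewrite le_eqVlt; apply/orP; left; apply/eqP; rewrite -/a -/b; ring.
have qn e : 0 < e -> exists N, D * q ^+ N < e.
  move=> e0.
  have /cvgrPdist_lt /(_ e e0) [N _ hN] : (D * q ^+ n) @[n --> \oo] --> (0 : R).
    have := @cvg_geometric R D q; rewrite ger0_norm// => /(_ q1).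
    exact.
  exists N; have := hN N (leqnn N); rewrite /= sub0r normrN ger0_norm//.
  by rewrite mulr_ge0 ?exprn_ge0.
have [|l ly] := @rnorm_cauchy_cvg y.
  move=> e /qn[N Ne]; exists N => n Nn; apply: le_lt_trans Ne.
  rewrite -(subnKC Nn); apply: le_trans (dist _ _) _.
  apply: ler_piMr; first by rewrite mulr_ge0// exprn_ge0.
  by rewrite lerBlDr lerDl exprn_ge0.
exists l; apply/eqP; rewrite -subr_eq0 -rnorm_eq0 eq_le rnorm_ge0 andbT.
rewrite leNgt; apply/negP => hl.
(* If [h l] differed from [l], a late iterate and its successor would both lie within half their
   distance of [l], contradicting the triangle inequality through [h (y N)]. *)
have [|N lN] := ly (rnorm (h l - l) / 2); first by rewrite divr_gt0.
have := rnormD (h l - h (y N)) (y N.+1 - l); rewrite addrA subrK.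
have := hq l (y N); have := lN N (leqnn N); have := lN N.+1 (leqnSn N).
rewrite [rnorm (y N.+1 - l)]rnormB.
have : q * rnorm (l - y N) <= rnorm (l - y N) by rewrite ler_piMl ?rnorm_ge0// ltW.
lra.
Qed.

End FixedPoint.

(** * Operator norm, inverses, and perturbations of an invertible operator *)

Section OperatorNorm.
Context {R : realType} {X : completeNormedModType R[i]}.
Implicit Types A B E : {linear X -> X}.

Lemma BL_rnormP A :
  BL X A <-> exists2 M : R, 0 <= M & forall x, rnorm (A x) <= M * rnorm x.
Proof.
split=> [/linear_boundedP/pinfty_ex_gt0[M M0 AM]|[M M0 AM]].
  have ME : M = (complex.Re M)%:C by rewrite RRe_real// gtr0_real.
  exists (complex.Re M); first by rewrite -lecR -ME ltW.
  by move=> x; have := AM x; rewrite ME !rnormE -rmorphM lecR.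
apply/bounded_funP => r; exists (M%:C * r) => x xr.
apply: (@le_trans _ _ (M%:C * `|x|)).
  by rewrite !rnormE -rmorphM lecR.
by rewrite ler_wpM2l// lecR.
Qed.

Lemma op_norm_le A (M : R) : 0 <= M ->
  (forall x, rnorm (A x) <= M * rnorm x) -> op_norm A <= M.
Proof.
move=> M0 AM; apply: ge_sup.
  by exists (rnorm (A 0)); exists 0 => //=; rewrite normr0.
move=> _ [x /= x1 <-]; apply: le_trans (AM x) _.
by rewrite ler_piMr// -lecR -rnormE.
Qed.

Lemma op_norm_ub A x : BL X A -> `|x| <= 1 -> rnorm (A x) <= op_norm A.
Proof.
move=> /BL_rnormP[M M0 AM] x1; apply: ub_le_sup; last by exists x.
exists M => _ [z /= z1 <-]; apply: le_trans (AM z) _.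
by rewrite ler_piMr// -lecR -rnormE.
Qed.

Lemma op_norm_ge0 A : BL X A -> 0 <= op_norm A.
Proof.
move=> /(op_norm_ub (x := 0)); rewrite normr0 => /(_ ler01).
by rewrite linear0 rnorm0.
Qed.

Lemma rnorm_op_le A x : BL X A -> rnorm (A x) <= op_norm A * rnorm x.
Proof.
move=> bA; have [->|x0] := eqVneq x 0; first by rewrite linear0 rnorm0 mulr0.
have nx0 : 0 < rnorm x by rewrite lt_neqAle eq_sym rnorm_eq0 x0 rnorm_ge0.
pose y := (rnorm x)^-1%:C *: x.
have ny : rnorm y = 1.
  by rewrite rnormZ_real ger0_norm ?invr_ge0 ?rnorm_ge0// mulVf// gt_eqF.
have := @op_norm_ub A y bA; rewrite rnormE ny lexx => /(_ isT).
rewrite /y linearZ/= rnormZ_real ger0_norm ?invr_ge0 ?rnorm_ge0//.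
by rewrite ler_pdivrMl// mulrC.
Qed.

(** [op_shift A 0] is compared with [A] only pointwise, so norms and inverses are transported along
    [=1]. *)
Lemma eq_op_norm A B : A =1 B -> op_norm A = op_norm B.
Proof. by move=> AB; congr (sup _); apply: eq_imagel => x _; rewrite AB. Qed.

Lemma eq_op_inverse A A' B : A =1 A' -> op_inverse A B -> op_inverse A' B.
Proof. by move=> AA' [bB AK BK]; split=> // x; rewrite -AA'. Qed.

Lemma op_shift0 A : op_shift A 0 =1 A.
Proof. by move=> x; rewrite /op_shift /= scale0r subr0. Qed.

Lemma singularE A : singular A <-> ~ op_invertible A.
Proof.
by split=> h [B] /eq_op_inverse AB; apply: h; exists B; apply: AB => x;
  rewrite op_shift0.
Qed.

Lemma op_inverse_unique A B B' : op_inverse A B -> op_inverse A B' -> B =1 B'.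
Proof. by move=> [_ AK BK] [_ AK' BK'] x; rewrite -{1}(BK' x) AK. Qed.

(* [A x + E x = y] is the fixed-point equation [x = B (y - E x)]. *)
Lemma op_invertible_perturb A B E : BL X E -> op_inverse A B ->
  op_norm E * op_norm B < 1 -> op_invertible (op_add A E).
Proof.
move=> bE [bB AK BK] EB1; set T := op_add A E.
have TE x : T x = A x + E x by [].
have e0 := op_norm_ge0 bE; have b0 := op_norm_ge0 bB.
set q := op_norm E * op_norm B in EB1; have q0 : 0 <= q by exact: mulr_ge0.
have BEle x : rnorm (B (E x)) <= q * rnorm x.
  apply: le_trans (rnorm_op_le _ bB) _; rewrite /q mulrC mulrAC.
  by rewrite ler_wpM2r// rnorm_op_le.
(* From [x = B (T x) - B (E x)]. This bound yields both the injectivity of [T] and the boundedness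
   of its inverse. *)
have Tlow x : rnorm x <= op_norm B / (1 - q) * rnorm (T x).
  have q1 : 0 < 1 - q by rewrite subr_gt0.
  rewrite mulrAC ler_pdivlMr//.
  have := rnorm_op_le (T x) bB; have := BEle x.
  have -> : B (T x) = x + B (E x) by rewrite TE linearD AK.
  have := rnormD (x + B (E x)) (- B (E x)); rewrite addrK.
  have -> : rnorm (- B (E x)) = rnorm (B (E x)) by rewrite /rnorm normrN.
  lra.
have Tinj x y : T x = T y -> x = y.
  move=> Txy; apply/eqP; rewrite -subr_eq0 -rnorm_eq0 eq_le rnorm_ge0 andbT.
  by apply: le_trans (Tlow _) _; rewrite linearB Txy subrr rnorm0 mulr0.
have Tsurj y : exists x, T x = y.
  have [||x xE] := @rnorm_contraction_fixpoint _ _ (fun x => B (y - E x)) q.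
  - by rewrite q0.
  - move=> u v; rewrite -linearB opprB addrCA addrAC subrr add0r -linearB.
    by rewrite [X in _ <= _ * X]rnormB; exact: BEle.
  exists x; rewrite TE -{1}xE BK subrK//.
have [g gE] := choice Tsurj.
have gl : linear g.
  by move=> a x y; apply: Tinj; rewrite linearP !gE.
pose G : {linear X -> X} := HB.pack g (GRing.isLinear.Build _ _ _ _ g gl).
exists G; split=> [|x|x]; last exact: gE.
  apply/BL_rnormP; exists (op_norm B / (1 - q)) => [|x].
    by rewrite divr_ge0// subr_ge0 ltW.
  by have := Tlow (g x); rewrite gE.
by apply: Tinj; rewrite gE.
Qed.

(** Some [y] in the unit ball has [rnorm (B y)] above [e^-1]. A rank-one operator sending [B y] to
    [- y], which is [- A (B y)], cancels [A] there, and a norming functional keeps its norm below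
    [e]. *)
Lemma exists_singular_perturbation A B (e : R) : op_inverse A B ->
  0 < e -> e^-1 < op_norm B ->
  exists E, [/\ BL X E, singular (op_add A E) & op_norm E <= e].
Proof.
move=> [bB AK BK] e0 eB.
pose S := [set rnorm (B x) | x in [set x : X | `|x| <= 1]].
have [_ [y /= y1 <-] ey] : exists2 r, S r & e^-1 < r.
  (* This slack puts the threshold for [rnorm (B y)] exactly at [e^-1]. *)
  have := @sup_adherent R S (op_norm B - e^-1).
  rewrite subr_gt0 => /(_ eB) [|r Er]; last first.
    by rewrite opprB addrCA subrr addr0; exists r.
  split; first by exists (rnorm (B 0)); exists 0 => //=; rewrite normr0.
  by exists (op_norm B) => _ [x /= x1 <-]; exact: op_norm_ub.
have By0 : 0 < rnorm (B y) by apply: lt_trans ey; rewrite invr_gt0.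
have [f [fl fb fBy]] := complex_hahn_banach (B y).
pose Ef x : X := - (f x / `|B y|) *: y.
have El : linear Ef.
  move=> a u v; rewrite /Ef fl/= mulrDl opprD scalerDl scalerA.
  by congr (_ *: _ + _); rewrite -mulrA mulrN.
pose E : {linear X -> X} := HB.pack Ef (GRing.isLinear.Build _ _ _ _ Ef El).
have Eb x : rnorm (E x) <= e * rnorm x.
  rewrite -lecR rmorphM/= -!rnormE /E/= /Ef normrZ normrN normrM normfV normr_id.
  apply: (@le_trans _ _ (`|x| / `|B y| * 1)).
    rewrite ler_pM ?mulr_ge0 ?invr_ge0 ?normr_ge0//.
    by rewrite ler_wpM2r ?invr_ge0 ?normr_ge0.
  rewrite mulr1 mulrC ler_wpM2r ?normr_ge0// rnormE -fmorphV lecR.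
  by rewrite -[e]invrK lef_pV2 ?posrE ?invr_gt0// ltW.
have bE : BL X E by apply/BL_rnormP; exists e => //; exact: ltW.
exists E; split=> //; last by apply: op_norm_le => //; exact: ltW.
apply/singularE => -[G [_ TK _]].
have T0 : op_add A E (B y) = 0.
  rewrite /op_add /= BK /E /= /Ef fBy divff ?scaleN1r ?subrr//.
  by rewrite rnormE -[0]/(0%:C) (inj_eq (@complexI R)) gt_eqF.
have := TK (B y); rewrite T0 linear0 => By; move: By0.
by rewrite -By rnorm0 ltxx.
Qed.

End OperatorNorm.

(** * The distance to singularity as a supremum over condition pseudospectra *)

Unset Implicit Arguments.

Theorem theorem5p4 (R : realType) (X : completeNormedModType R[i])
    (A : {linear X -> X}) (hA : (BL X `\` scalar_op X) A) :
  dist_singular A =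
  sup [set eps : R | 0 < eps /\ ~ cond_pseudospectrum (eps / op_norm A) A 0].
Proof.
have [bA Ans] := hA.
(* The zero operator is the scalar operator with factor 0. *)
have [x0 Ax0] : exists x, A x != 0.
  apply: contrapT => /forallNP A0; apply: Ans; exists 0 => x.
  by rewrite scale0r; apply/eqP; apply: contrapT => /negP; exact: A0.
have nA0 : 0 < op_norm A.
  rewrite lt_neqAle op_norm_ge0// andbT eq_sym; apply/eqP => nA.
  move: Ax0; rewrite -rnorm_eq0 eq_le rnorm_ge0 andbT.
  by have := rnorm_op_le x0 bA; rewrite nA mul0r => ->.
pose S := [set op_norm E | E in [set E | BL X E /\ singular (op_add A E)]].
have Sge0 : lbound S 0 by move=> _ [E [bE _] <-]; exact: op_norm_ge0.
have [[B AB]|nAinv] := pselect (op_invertible A); last first.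
  transitivity (0 : R).
    pose Z : {linear X -> X} := \0.
    have Z0 x : Z x = 0 by [].
    have bZ : BL X Z.
      by apply/BL_rnormP; exists 0 => // x; rewrite Z0 rnorm0 mul0r.
    have SZ : S (op_norm Z).
      exists Z => //; split=> //; apply/singularE => -[B AB]; apply: nAinv.
      by exists B; apply: eq_op_inverse AB => x; rewrite /op_add /= addr0.
    apply/le_anti/andP; split; last by apply: lb_le_inf => //; exists (op_norm Z).
    apply: (@le_trans _ _ (op_norm Z)); first by apply: ge_inf => //; exists 0.
    by apply: op_norm_le => // x; rewrite Z0 rnorm0 mul0r.
  rewrite -[LHS](@sup0 R); congr sup; apply/seteqP; split=> // e [e0]; apply.
  rewrite /cond_pseudospectrum; case: ifPn => // _; left.
  exact/singularE.
have [bB AK BK] := AB.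
have x00 : 0 < rnorm x0.
  rewrite lt_neqAle rnorm_ge0 andbT eq_sym rnorm_eq0; apply: contraNneq Ax0 => ->.
  by rewrite linear0.
(* Besides giving [0 < op_norm B], this places every [e] below [(op_norm B)^-1] in the range
   [e / op_norm A < 1]. *)
have AB1 : 1 <= op_norm A * op_norm B.
  have := rnorm_op_le (A x0) bB; rewrite AK => h.
  rewrite -(ler_pM2r x00) mul1r; apply: le_trans h _.
  rewrite [op_norm A * _]mulrC -mulrA ler_wpM2l ?op_norm_ge0//.
  exact: rnorm_op_le.
have nB0 : 0 < op_norm B.
  by rewrite -(pmulr_rgt0 _ nA0); apply: lt_le_trans AB1.
transitivity (op_norm B)^-1.
  apply/le_anti/andP; split.
    (* The margin [d] provides the strict inequality needed to choose [y], as [op_norm B] need not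
       be attained. *)
    apply/ler_addgt0Pr => d d0.
    have e0 : 0 < (op_norm B)^-1 + d by rewrite addr_gt0 ?invr_gt0.
    have [|E [bE sE Ee]] := exists_singular_perturbation AB e0.
      by rewrite -[ltRHS]invrK ltf_pV2 ?posrE ?invr_gt0// ltrDl.
    apply: le_trans Ee; apply: ge_inf; first by exists 0.
    by exists E.
  apply: lb_le_inf.
    (* Any number above [(op_norm B)^-1] would do; only nonemptiness is at stake. *)
    have [||E [bE sE _]] := @exists_singular_perturbation _ _ A B (2 / op_norm B) AB.
    - by rewrite divr_gt0.
    - by rewrite invfM invrK gtr_pMl// invf_lt1// ltr1n.
    by exists (op_norm E); exists E.
  move=> _ [E [bE /singularE sE] <-]; rewrite leNgt; apply/negP => Elt.
  apply: sE; apply: op_invertible_perturb bE AB _.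
  by rewrite -ltr_pdivlMr// mul1r.
(* The set on the right is the open interval from 0 to [(op_norm B)^-1]. Its upper end is excluded
   because the pseudospectrum is defined by a weak inequality, so the supremum is not a maximum. *)
rewrite -[LHS](@sup_itv R (BRight 0) true) ?bnd_simp ?invr_gt0//.
have ABs : op_inverse (op_shift A 0) B.
  by apply: eq_op_inverse AB => x; rewrite op_shift0.
congr sup; apply/seteqP; split=> e /=.
  rewrite in_itv/= => /andP[e0 eB]; split=> //.
  have eA : e / op_norm A < 1.
    rewrite ltr_pdivrMr// mul1r; apply: lt_le_trans eB _.
    by rewrite -[leLHS]mul1r ler_pdivrMr.
  rewrite /cond_pseudospectrum eA => -[|[B' AB']].
    by apply; exists B.
  rewrite (eq_op_norm (op_shift0 A)) (eq_op_norm (op_inverse_unique AB' ABs)).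
  rewrite invf_div ler_pM2l// => eB'.
  by move: eB; rewrite ltNge -[leRHS]invrK lef_pV2 ?posrE ?invr_gt0// eB'.
rewrite in_itv/= => -[e0 he]; rewrite e0/= ltNge; apply/negP => eB; apply: he.
(* For [e / op_norm A >= 1] the pseudospectrum is the whole plane; otherwise [B] witnesses the norm
   condition. *)
rewrite /cond_pseudospectrum; case: ifPn => // _; right; exists B => //.
rewrite (eq_op_norm (op_shift0 A)) invf_div ler_pM2l//.
by rewrite -[leRHS]invrK lef_pV2 ?posrE ?invr_gt0.
Qed.
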